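(* Let $(X,\tau,\mathfrak a)$ be an aura topological space. For all $A,B\subseteq X$, $$A\equiv_{\mathfrak a}B\iff K_{\mathfrak a}(A)=K_{\mathfrak a}(B)\iff \mathord{\uparrow}_{\mathfrak a}A=\mathord{\uparrow}_{\mathfrak a}B\iff S_{\mathfrak a}^{\infty}(A)=S_{\mathfrak a}^{\infty}(B).$$ Moreover, for every $A\subseteq X$, $K_{\mathfrak a}(A)=\mathord{\uparrow}_{\mathfrak a}A=S_{\mathfrak a}^{\infty}(A)$.
   Context: $X$ is a nonempty set. An aura topological space is a triple $(X,\tau,\mathfrak a)$ where $(X,\tau)$ is a topological space and $\mathfrak a:X\to\tau$ (the scope function) satisfies $x\in\mathfrak a(x)$ for every $x\in X$. A set $U\subseteq X$ is $\mathfrak a$-open (aura-open) if $\{x\in U:\mathfrak a(x)\subseteq U\}=U$; the family of all $\mathfrak a$-open sets is denoted $\tau_{\mathfrak a}$ and is known to be a topology on $X$. The scope relation is $xR_{\mathfrak a}y\iff y\in\mathfrak a(x)$, and $\preccurlyeq_{\mathfrak a}$ is its reflexive-transitive closure. For $A\subseteq X$: $\mathord{\uparrow}_{\mathfrak a}A=\{y\in X:\exists x\in A,\ x\preccurlyeq_{\mathfrak a}y\}$; $S_{\mathfrak a}(A)=\bigcup_{x\in A}\mathfrak a(x)$, $S_{\mathfrak a}^0(A)=A$, $S_{\mathfrak a}^{n+1}(A)=S_{\mathfrak a}(S_{\mathfrak a}^n(A))$, $S_{\mathfrak a}^{\infty}(A)=\bigcup_{n\ge0}S_{\mathfrak a}^n(A)$.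 Aura-Levine equivalence: $A\equiv_{\mathfrak a}B$ means that for every $U\in\tau_{\mathfrak a}$, $A\subseteq U\iff B\subseteq U$. The canonical hull is $K_{\mathfrak a}(A)=\bigcap\{U\in\tau_{\mathfrak a}:A\subseteq U\}$. *)

(* Defs.v *)
From HB Require Import structures.
From mathcomp Require Import all_boot all_order all_algebra.
From mathcomp Require Import all_classical topology.
From Stdlib Require Import Relation_Operators.

Set Implicit Arguments.
Unset Strict Implicit.
Unset Printing Implicit Defensive.

Local Open Scope classical_set_scope.

Record scope_function (X : topologicalType) := ScopeFunction {
  scope :> X -> set X ;
  scope_open : forall x, open (scope x) ;
  scope_mem : forall x, scope x x }.

Section Aura.
Context {X : topologicalType} (a : scope_function X).
Implicit Types (A B U : set X) (x y : X).

Definition aura_open U : Prop := [set x | U x /\ a x `<=` U] = U.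

Definition aura_topology : set (set X) := [set U | aura_open U].

Definition scope_rel x y : Prop := a x y.

Definition scope_le x y : Prop := clos_refl_trans X scope_rel x y.

Definition aura_up A : set X := [set y | exists2 x, A x & scope_le x y].

Definition aura_step A : set X := \bigcup_(x in A) a x.

Definition aura_iter n A : set X := iter n aura_step A.

Definition aura_iter_infty A : set X := \bigcup_n aura_iter n A.

Definition aura_levine A B : Prop :=
  forall U, aura_topology U -> (A `<=` U <-> B `<=` U).

Definition aura_hull A : set X :=
  \bigcap_(U in [set U | aura_topology U /\ A `<=` U]) U.

End Aura.

(* Main.v *)
Require Import Defs.
From mathcomp Require Import all_boot all_order all_algebra.
From mathcomp Require Import all_classical topology.
From Stdlib Require Import Relation_Operators.

Local Open Scope classical_set_scope.

(** The aura-open sets are exactly the sets closed under the scope relation,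
    hence the up-sets of the preorder it generates ([aura_openP],
    [aura_open_le]).  So the up-closure of [A] is the least aura-open set
    containing [A], which is what the hull of [A] is ([aura_hull_up]).  The
    iterated scopes compute the same set: membership in the [n]-th iterate
    records a chain of [n] scope steps out of [A], and the reflexive-transitive
    closure is the existence of a finite chain ([aura_up_iter]).

    Once the three operators agree, the equality conditions on the pair [A], [B]
    coincide.  The Levine condition joins them because an aura-open set
    contains [A] exactly when it contains the hull of [A], so the hull and the
    family of aura-open supersets determine each other ([aura_levine_hull]). *)

Section AuraHull.
Context {X : topologicalType} (a : scope_function X).
Implicit Types A B U : set X.

Lemma aura_openP U : aura_open a U <-> forall x, U x -> a x `<=` U.
Proof.
split=> [oU x|clU]; first by rewrite -{1}oU => -[].
by apply/seteqP; split=> [x []//|x Ux]; split=> //; exact: clU.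
Qed.

Lemma aura_open_le U x y : aura_open a U -> scope_le a x y -> U x -> U y.
Proof.
move=> /aura_openP clU; elim=> [u v auv Uu|//|u v w _ IHuv _ IHvw Uu].
  exact: clU Uu _ auv.
exact/IHvw/IHuv.
Qed.

Lemma aura_up_open A : aura_open a (aura_up a A).
Proof.
apply/aura_openP => y [x Ax lexy] z ayz; exists x => //.
by apply: rt_trans lexy _; exact: rt_step.
Qed.

Lemma sub_aura_up A : A `<=` aura_up a A.
Proof. by move=> x Ax; exists x => //; exact: rt_refl. Qed.

Lemma aura_hull_up A : aura_hull a A = aura_up a A.
Proof.
apply/seteqP; split=> [y|y [x Ax lexy] U [oU AU]].
  by apply; split; [exact: aura_up_open | exact: sub_aura_up].
exact: aura_open_le oU lexy (AU _ Ax).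
Qed.

Lemma aura_iter_infty_open A : aura_open a (aura_iter_infty a A).
Proof. by apply/aura_openP => x [n _ Anx] y axy; exists n.+1 => //; exists x. Qed.

Lemma aura_iter_sub_up n A : aura_iter a n A `<=` aura_up a A.
Proof.
elim: n => [|n IHn]; first exact: sub_aura_up.
move=> y [x /IHn Ax axy]; exact: (aura_openP _).1 (aura_up_open A) _ Ax _ axy.
Qed.

(** Chains need not be cut into single steps by hand: the union of the iterates
    is aura-open and contains [A], so it absorbs everything above [A]. *)
Lemma aura_up_iter A : aura_up a A = aura_iter_infty a A.
Proof.
apply/seteqP; split=> [y [x Ax lexy]|y [n _ Any]].
  by apply: aura_open_le (aura_iter_infty_open A) lexy _; exists 0%N.
exact: aura_iter_sub_up Any.
Qed.

Lemma aura_hull_subE A U : aura_topology a U -> aura_hull a A `<=` U <-> A `<=` U.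
Proof.
move=> oU; split=> [hU x Ax|AU x]; last by apply.
by apply: hU => V [_]; exact.
Qed.

Lemma aura_levine_hull A B :
  aura_levine a A B <-> aura_hull a A = aura_hull a B.
Proof.
split=> [AB|eqAB U oU].
  by apply: eq_bigcapl; split=> U [oU] /(AB U oU) sU; split.
by rewrite -(aura_hull_subE A U oU) -(aura_hull_subE B U oU) eqAB.
Qed.

End AuraHull.

Theorem theorem4p2 (X : topologicalType) (X_neq0 : [set: X] !=set0)
    (a : scope_function X) :
  (forall A B : set X,
    [/\ aura_levine a A B <-> aura_hull a A = aura_hull a B,
        aura_hull a A = aura_hull a B <-> aura_up a A = aura_up a B &
        aura_up a A = aura_up a B <->
          aura_iter_infty a A = aura_iter_infty a B]) /\
  (forall A : set X,
    aura_hull a A = aura_up a A /\ aura_up a A = aura_iter_infty a A).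
Proof.
split=> [A B|A]; last by rewrite aura_hull_up aura_up_iter.
split; first exact: aura_levine_hull.
- by rewrite !aura_hull_up.
- by rewrite !aura_up_iter.
Qed.
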